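(* Let $G$ be a simple connected graph with $n$ nodes and $m$ edges, let $q\ge1$ and $k\ge0$ be integers, and let $\hat{\mathcal K}_{q,k}$ denote the multiplicative degree-Kirchhoff index of the iterated $q$-triangulation graph $R_{q,k}(G)$ (so $\hat{\mathcal K}_{q,0}=\hat{\mathcal K}(G)$). Then $$\hat{\mathcal K}_{q,k}=\Big(\frac{2(2q+1)^2}{q+2}\Big)^k\hat{\mathcal K}_{q,0}+\frac{m^2(2q+3)}{2q+1}\Big[(2q+1)^{2k}-\Big(\frac{2(2q+1)^2}{q+2}\Big)^k\Big]+\bigg(\frac{2m(q-1)}{3(2q+1)}+\frac{m(m-2n)}{3}\bigg)\Big[\Big(\frac{2(2q+1)^2}{q+2}\Big)^k-(2q+1)^k\Big].$$
   Context: For a positive integer $q$, the $q$-triangulation graph $R_q(G)$ is obtained from $G$ by keeping all nodes and edges of $G$ and adding, for each edge $uv$ of $G$, $q$ disjoint paths of length $2$: $ux_1v,\dots,ux_qv$, where $x_1,\dots,x_q$ are new nodes. The iterated $q$-triangulation graphs are $R_{q,0}(G)=G$ and $R_{q,k}(G)=R_q(R_{q,k-1}(G))$ for $k\ge1$. The resistance distance $r_{ij}$ between nodes $i,j$ of a simple connected graph is the effective resistance between them when every edge is replaced by a unit resistor. With $d_i$ the degree of node $i$, the multiplicative degree-Kirchhoff index is $\hat{\mathcal K}(G)=\sum_{\{i,j\}\subseteq V(G)}d_id_jr_{ij}=\frac12\sum_{i,j}d_id_jr_{ij}$. *)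

(* Defs.v *)
From HB Require Import structures.
From mathcomp Require Import all_boot all_order all_algebra.
Set Implicit Arguments.
Unset Strict Implicit.
Unset Printing Implicit Defensive.

Import Order.TTheory GRing.Theory Num.Theory.

Record sgraph := SGraph {
  svertex :> finType;
  sedge : rel svertex;
  sedge_sym : symmetric sedge;
  sedge_irrefl : irreflexive sedge }.

Definition edges (G : sgraph) : {set {set G}} :=
  [set [set p.1; p.2] | p in [set p : G * G | sedge p.1 p.2]].

Definition degree (G : sgraph) (x : G) : nat := #|[set y | sedge x y]|.

Definition sconnected (G : sgraph) : Prop :=
  0 < #|G| /\ forall x y : G, connect (@sedge G) x y.

Section Triangulation.
Variables (q : nat) (G : sgraph).

(* [inl u] is an old node; [inr (A, i)] is the middle node of the [i]-th path
   of length 2 joining the two endpoints of the edge [A]. *)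
Definition triangulation_vertex : finType :=
  (G + {A : {set G} | A \in edges G} * 'I_q)%type.

Definition triangulation_edge : rel triangulation_vertex :=
  fun a b => match a, b with
  | inl u, inl v => sedge u v
  | inl u, inr (A, _) => u \in val A
  | inr (A, _), inl v => v \in val A
  | inr _, inr _ => false
  end.

Fact triangulation_sym : symmetric triangulation_edge.
Proof. by move=> [u|[A i]] [v|[B j]] //=; apply: sedge_sym. Qed.

Fact triangulation_irrefl : irreflexive triangulation_edge.
Proof. by move=> [u|[A i]] //=; apply: sedge_irrefl. Qed.

Definition triangulation : sgraph :=
  SGraph triangulation_sym triangulation_irrefl.

End Triangulation.

Definition iter_triangulation (q k : nat) (G : sgraph) : sgraph :=
  iter k (triangulation q) G.

Local Open Scope ring_scope.

Section Resistance.
Variables (R : realFieldType) (G : sgraph).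
Implicit Types (p : {ffun G -> R^o}) (i j x y : G).

(* Net current flowing out of each node, through unit resistors, when the
   nodes are held at the potentials [p] (Ohm's and Kirchhoff's laws). *)
Definition net_current p : {ffun G -> R^o} :=
  [ffun x => \sum_(y | sedge x y) (p x - p y)].

(* A unit current enters at [i] and leaves at [j]. *)
Definition unit_source i j : {ffun G -> R^o} :=
  [ffun x => (x == i)%:R - (x == j)%:R].

(* [^-1] is a one-sided inverse of a linear map, so on a connected graph this
   is a potential inducing the unit current from [i] to [j] (lemma
   [net_current_potential]). *)
Definition potential i j : {ffun G -> R^o} :=
  ((linfun net_current)^-1)%VF (unit_source i j).

Definition resistance i j : R := potential i j i - potential i j j.

Definition mult_degree_Kirchhoff : R :=
  2^-1 * \sum_(i : G) \sum_(j : G)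
    (degree i)%:R * (degree j)%:R * resistance i j.

Fact net_current_is_linear : linear net_current.
Proof.
move=> a p p'; apply/ffunP=> x; rewrite !ffunE scaler_sumr -big_split /=.
by apply: eq_bigr => y _; rewrite !ffunE scalerBr opprD addrACA.
Qed.

HB.instance Definition _ := GRing.isLinear.Build R
  {ffun G -> R^o} {ffun G -> R^o} *:%R net_current net_current_is_linear.

Lemma net_current_energy p :
  \sum_x \sum_(y | sedge x y) (p x - p y) ^+ 2
    = 2 * \sum_x p x * net_current p x.
Proof.
have E (F : G -> G -> R) : \sum_x \sum_(y | sedge x y) F x y =
    \sum_x \sum_(y | sedge x y) F y x.
  rewrite (exchange_big_dep predT) //=; apply: eq_bigr => x _.
  by apply: eq_bigl => y; apply: sedge_sym.
have -> : \sum_x p x * net_current p x =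
    \sum_x \sum_(y | sedge x y) p x * (p x - p y).
  by apply: eq_bigr => x _; rewrite ffunE mulr_sumr.
rewrite mulr_natl mulr2n [in X in _ = _ + X](E (fun x y => p x * (p x - p y))).
rewrite -big_split /=; apply: eq_bigr => x _.
rewrite -big_split /=; apply: eq_bigr => y _.
by rewrite -[p y - p x]opprB mulrN -mulrBl expr2.
Qed.

Lemma net_current_eq0 p :
  sconnected G -> net_current p = 0 -> forall x y, p x = p y.
Proof.
move=> Gc p0; have n0 x : (0 : {ffun G -> R^o}) x = 0 by rewrite ffunE.
have := net_current_energy p.
rewrite p0 [X in 2 * X]big1 ?mulr0 => [|x _]; last by rewrite n0 mulr0.
have ge0 x : 0 <= \sum_(y | sedge x y) (p x - p y) ^+ 2.
  by apply: sumr_ge0 => y _; apply: sqr_ge0.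
move/eqP; rewrite psumr_eq0 // => /allP z0.
have step x y : sedge x y -> p x = p y.
  move=> xy; have := z0 x (mem_index_enum x).
  rewrite /= psumr_eq0 => [/allP/(_ y (mem_index_enum y))|? _].
    by rewrite /= xy sqrf_eq0 subr_eq0 => /eqP.
  exact: sqr_ge0.
move=> x y; have /connectP[s xs ->] := Gc.2 x y.
elim: s x xs => //= z s IHs x /andP[/step -> /IHs]; exact.
Qed.

Lemma net_current_potential i j :
  sconnected G -> net_current (potential i j) = unit_source i j.
Proof.
move=> Gc.
pose f := linfun net_current.
have fE p : f p = net_current p by rewrite lfunE.
suff s_im : unit_source i j \in limg f by rewrite -fE limg_lfunVK.
pose total (p : {ffun G -> R^o}) : R^o := \sum_x p x.
have total_lin : linear total.
  move=> a p p'; rewrite /total scaler_sumr -big_split /=.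
  by apply: eq_bigr => x _; rewrite !ffunE.
pose tM := GRing.isLinear.Build R {ffun G -> R^o} R^o *:%R total total_lin.
pose tL : {linear {ffun G -> R^o} -> R^o} := HB.pack total tM.
pose g := linfun tL; have gE p : g p = total p by rewrite lfunE.
have dim1 : (\dim (lker f) <= 1)%N.
  pose c : {ffun G -> R^o} := [ffun=> 1].
  suff sub : (lker f <= <[c]>)%VS.
    by apply: leq_trans (dimvS sub) _; rewrite dim_vline; case: eqP.
  apply/subvP=> p; rewrite memv_ker fE => /eqP/(net_current_eq0 Gc) pc.
  apply/vlineP; exists (p i); apply/ffunP=> x.
  by rewrite !ffunE /GRing.scale /= mulr1.
have sub : (limg f <= lker g)%VS.
  apply/subvP=> _ /memv_imgP[p _ ->]; rewrite memv_ker gE fE /total.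
  under eq_bigr do rewrite ffunE sumrB.
  rewrite sumrB [X in _ - X](exchange_big_dep predT) //=.
  rewrite -sumrB big1 // => x _; rewrite -[X in X - _]/(\sum_(_ | _) _).
  by rewrite (eq_bigl _ _ (fun y => sedge_sym y x)) subrr.
have gnz : (0 < \dim (limg g))%N.
  rewrite lt0n dimv_eq0; apply/negP=> /eqP g0.
  have := memv_img g (memvf ([ffun x => (x == i)%:R] : {ffun G -> R^o})).
  rewrite g0 memv0 gE /total (bigD1 i) //= ffunE eqxx big1 ?addr0 ?oner_eq0 //.
  by move=> x /negbTE ni; rewrite ffunE ni.
have /eqP -> : limg f == lker g.
  rewrite -(dimv_leqif_eq sub) eqn_leq dimvS //=.
  have := limg_ker_dim f fullv; have := limg_ker_dim g fullv.
  rewrite !capfv => <- e; rewrite -(leq_add2l 1) addnC.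
  apply: (@leq_trans (\dim (lker g) + \dim (limg g))); first by rewrite leq_add2l.
  by rewrite -e leq_add2r.
rewrite memv_ker gE /total; under eq_bigr do rewrite ffunE.
have one z : \sum_x (x == z)%:R = 1 :> R.
  by rewrite (bigD1 z) //= eqxx big1 ?addr0 // => x /negbTE ->.
by rewrite sumrB !one subrr.
Qed.

(* Effective resistance is the potential difference for any unit flow. *)
Lemma resistanceP i j p : sconnected G ->
  net_current p = unit_source i j -> resistance i j = p i - p j.
Proof.
move=> Gc; rewrite -(net_current_potential i j Gc) => /eqP.
rewrite -subr_eq0 -linearB => /eqP/(net_current_eq0 Gc)/(_ i j).
rewrite !ffunE /resistance => /eqP; rewrite subr_eq => /eqP ->.
by rewrite addrAC [p j - _]addrC addrK addrC.
Qed.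

End Resistance.

(* Main.v *)
Require Import Defs.
From mathcomp Require Import all_boot all_order all_algebra.
From mathcomp Require Import ring.
Import GRing.Theory Num.Theory.
Local Open Scope ring_scope.

Set Implicit Arguments.
Unset Strict Implicit.
Unset Printing Implicit Defensive.

(** The proof computes with Green functions. Ground a connected graph at a node
    [o] and let [g a] be the potential of a unit current entering at [a] and
    leaving at [o]. By superposition [g a - g b] is a potential for the current
    from [a] to [b], so [r_ab = g a a - g b a - g a b + g b b]
    ([resistance_Green]), and the Kirchhoff index of a graph with [m] edges is
    [2 m] times the degree-weighted trace of [g], minus the degree-weighted sum
    of all its entries ([Kirchhoff_Green]). It remains to see how these two
    numbers change under one triangulation.

    For the Green function of the triangulation, consider the operation
    [endpoint_mean] that evaluates a function on the old nodes at any node of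
    the triangulation, a new node receiving the average of the two ends of its
    edge. A function extended in this way loses no current at the new nodes,
    and the [q] paths of resistance 2 in parallel with each edge multiply the
    currents at the old nodes by [(q + 2) / 2] ([net_current_endpoint_mean]).
    Dually, a unit current entering at a new node splits evenly between the two
    ends. Extending the Green function [h] of [G] in both arguments and scaling
    it by [2 / (q + 2)] therefore gives the Green function of the
    triangulation, up to a correction [1 / 2] at the diagonal entries of the
    new nodes ([triangulation_Green_grounded]).

    The degree-weighted sum of an extended function is [2 q + 1] times the one
    on [G] ([sum_degree_endpoint_mean]). This gives the sum of all entries at
    once. The trace is the same up to the fact that averaging [h] over the four
    pairs of ends of an edge is not averaging it over the two diagonal ones;
    the defect is [q / 2] times the sum of the currents [h w w - h w v] over all
    arcs, which Foster's identity evaluates as [n - 1] ([Foster]). Hence the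
    one-step recursion [Kirchhoff_triangulation].

    Finally a triangulation multiplies the number of edges by [2 q + 1] and
    leaves [m - 2 n] unchanged, so the recursion has explicit inhomogeneous
    terms, and the closed formula follows by induction. *)

(** * Sums over edges *)

Lemma sum_set2 (V : nmodType) (T : finType) (x y : T) (f : T -> V) :
  x != y -> \sum_(z in [set x; y]) f z = f x + f y.
Proof. by move=> xy; rewrite big_setU1 ?inE //= big_set1. Qed.

Lemma sum_indicator (R : pzSemiRingType) (T : finType) (P : pred T) (b : T) :
  \sum_(c | P c) (c == b)%:R = (P b)%:R :> R.
Proof.
rewrite big_mkcond (bigD1 b) //= eqxx big1 ?addr0 => [|c /negPf ->].
  by case: (P b).
by case: (P c).
Qed.

Lemma natr_add2_neq0 (R : realFieldType) (q : nat) : q%:R + 2 != 0 :> R.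
Proof. by rewrite -natrD pnatr_eq0 addn2. Qed.

Lemma sedge_neq (G : sgraph) (x y : G) : sedge x y -> x != y.
Proof. by apply: contraTneq => ->; rewrite sedge_irrefl. Qed.

Lemma edgesP (G : sgraph) (A : {set G}) :
  reflect (exists2 p : G * G, sedge p.1 p.2 & A = [set p.1; p.2])
    (A \in edges G).
Proof.
by apply: (iffP imsetP) => -[p pe ->]; exists p; rewrite ?inE // in pe *.
Qed.

Lemma mem_edges (G : sgraph) (u v : G) : sedge u v -> [set u; v] \in edges G.
Proof. by move=> uv; apply/edgesP; exists (u, v). Qed.

Lemma card_edge (G : sgraph) (A : {set G}) : A \in edges G -> #|A| = 2%N.
Proof. by case/edgesP=> p /sedge_neq pn ->; rewrite cards2 pn. Qed.

Lemma sum_incident_edges (V : nmodType) (G : sgraph) (u : G)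
    (F : {set G} -> V) :
  \sum_(A in edges G | u \in A) F A = \sum_(v | sedge u v) F [set u; v].
Proof.
have inj : {in [set v | sedge u v] &, injective (fun v => [set u; v])}.
  move=> v w; rewrite !inE => /sedge_neq uv _ /setP/(_ v).
  by rewrite !inE eqxx orbT eq_sym (negPf uv) => /esym/eqP.
transitivity (\sum_(v in [set v | sedge u v]) F [set u; v]); last first.
  by apply: eq_bigl => v; rewrite inE.
rewrite -(big_imset F inj); apply: eq_bigl => A; apply/andP/imsetP.
  case=> /edgesP[[x y] /= xy ->]; rewrite !inE => /orP[] /eqP ->.
    by exists y; rewrite ?inE.
  by exists x; rewrite ?inE 1?sedge_sym // setUC.
by case=> v; rewrite inE => uv ->; rewrite mem_edges // set21.
Qed.

(** Double counting of the incidences between nodes and edges, with the edges at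
    [w] listed by their other ends; this turns every sum over edges below into
    a sum over arcs. *)
Lemma sum_edge_ends (V : nmodType) (G : sgraph) (F : {set G} -> G -> V) :
  \sum_(A in edges G) \sum_(w in A) F A w
    = \sum_w \sum_(v | sedge w v) F [set w; v] w.
Proof.
rewrite (exchange_big_dep predT) //=; apply: eq_bigr => w _.
exact: (sum_incident_edges _ (F^~ w)).
Qed.

Lemma handshake (G : sgraph) : (\sum_(x : G) degree x)%N = (2 * #|edges G|)%N.
Proof.
have -> : (2 * #|edges G| = \sum_(A in edges G) \sum_(w in A) 1)%N.
  rewrite mulnC -sum_nat_const; apply: eq_bigr => A AG.
  by rewrite sum1_card (card_edge AG).
rewrite (sum_edge_ends (V := nat) (fun _ _ => 1%N)); apply: eq_bigr => x _.
by rewrite sum1_card /degree cardsE.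
Qed.

(** * Green functions and the Kirchhoff index *)

Section GreenFunction.
Variables (R : realFieldType) (G : sgraph).

(** The net current is written out as a sum, rather than with [net_current], so
    that [g] can be a plain function of two arguments. *)
Definition grounded_Green (o : G) (g : G -> G -> R) : Prop :=
  forall a x, \sum_(y | sedge x y) (g a x - g a y) = (x == a)%:R - (x == o)%:R.

Lemma grounded_Green_exists (o : G) :
  sconnected G -> grounded_Green o (fun a => potential R a o).
Proof.
move=> Gc a x; have /ffunP/(_ x) := net_current_potential R a o Gc.
by rewrite !ffunE.
Qed.

Variables (o : G) (g : G -> G -> R).
Hypotheses (G_connected : sconnected G) (g_Green : grounded_Green o g).

(** By superposition [g a - g b] is a potential for the unit current from [a] to
    [b]: the two currents leaving at [o] cancel. *)
Lemma resistance_Green a b :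
  resistance R a b = g a a - g b a - g a b + g b b.
Proof.
rewrite (@resistanceP _ _ _ _ [ffun x => g a x - g b x]) // ?ffunE; first by ring.
apply/ffunP=> x; rewrite !ffunE.
transitivity (\sum_(y | sedge x y) (g a x - g a y)
    - \sum_(y | sedge x y) (g b x - g b y)).
  by rewrite -sumrB; apply: eq_bigr => y _; rewrite !ffunE; ring.
by rewrite !g_Green; ring.
Qed.

(** The inner sum is the net current of [g w] at [w], which is 1 unless [w] is
    the ground. Symmetrized over the arcs, this is Foster's theorem that the
    resistances across the edges of a connected graph add up to [n - 1]. *)
Lemma Foster : \sum_w \sum_(v | sedge w v) (g w w - g w v) = #|G|%:R - 1.
Proof.
under eq_bigr do rewrite g_Green eqxx.
rewrite sumrB sumr_const (bigD1 o) //= eqxx big1 ?addr0 // => x /negPf -> //.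
Qed.

(** The two diagonal terms of [resistance_Green] have equal degree-weighted sums,
    and so do its two other terms, by exchanging the summation indices. *)
Lemma Kirchhoff_Green :
  mult_degree_Kirchhoff R G =
    2 * #|edges G|%:R * \sum_(x : G) (degree x)%:R * g x x
    - \sum_(x : G) \sum_(y : G) (degree x)%:R * (degree y)%:R * g x y.
Proof.
set H := \sum_x _ * _; set B := \sum_x \sum_y _.
have dd : \sum_(x : G) (degree x)%:R = 2 * #|edges G|%:R :> R.
  by rewrite -natr_sum handshake natrM.
have EH : \sum_(x : G) \sum_(y : G) (degree x)%:R * (degree y)%:R * g x x
    = 2 * #|edges G|%:R * H.
  rewrite mulr_sumr; apply: eq_bigr => x _.
  by rewrite -mulr_suml -mulr_sumr dd; ring.
rewrite /mult_degree_Kirchhoff.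
transitivity (2^-1 * (\sum_(x : G) \sum_(y : G) (degree x)%:R * (degree y)%:R * g x x
   + \sum_(x : G) \sum_(y : G) (degree x)%:R * (degree y)%:R * g y y
   - B - \sum_(x : G) \sum_(y : G) (degree x)%:R * (degree y)%:R * g y x)).
  congr (_ * _); rewrite -big_split -!sumrB; apply: eq_bigr => x _.
  rewrite -big_split -!sumrB; apply: eq_bigr => y _ /=.
  by rewrite resistance_Green; ring.
have swap (F : G -> G -> R) :
    \sum_(x : G) \sum_(y : G) (degree x)%:R * (degree y)%:R * F y x
    = \sum_(x : G) \sum_(y : G) (degree x)%:R * (degree y)%:R * F x y.
  rewrite exchange_big; apply: eq_bigr => x _; apply: eq_bigr => y _.
  by rewrite [_%:R * _%:R]mulrC.
rewrite (swap g) (swap (fun x y => g x x)).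
by rewrite EH -/B; field.
Qed.

End GreenFunction.

(** * The structure of a triangulation *)

Section OneStep.
Variables (R : realFieldType) (q : nat) (G : sgraph).
Notation T := (triangulation q G).
Notation E := {A : {set G} | A \in edges G}.

Lemma sum_vertices (V : nmodType) (F : T -> V) :
  \sum_c F c = \sum_u F (inl u) + \sum_(A : E) \sum_(i < q) F (inr (A, i)).
Proof.
rewrite [LHS]big_sumType /=; congr (_ + _).
by rewrite pair_bigA; apply: eq_bigr => -[].
Qed.

Lemma sum_neighbors_old (V : nmodType) (u : G) (F : T -> V) :
  \sum_(c | sedge (inl u : T) c) F c = \sum_(v | sedge u v) F (inl v)
    + \sum_(A : E | u \in val A) \sum_(i < q) F (inr (A, i)).
Proof.
rewrite [LHS]big_sumType /=; congr (_ + _).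
by rewrite pair_big_dep; apply: eq_big => [[]|[]]//= A i; rewrite andbT.
Qed.

Lemma sum_neighbors_new (V : nmodType) (A : E) (i : 'I_q) (F : T -> V) :
  \sum_(c | sedge (inr (A, i) : T) c) F c = \sum_(v in val A) F (inl v).
Proof.
by rewrite [LHS]big_sumType /= [X in _ + X]big_pred0 ?addr0 // => -[].
Qed.

Lemma degreeE (H : sgraph) (x : H) : (degree x)%:R = \sum_(y | sedge x y) 1 :> R.
Proof. by rewrite sumr_const /degree cardsE. Qed.

Lemma degree_old (u : G) : (degree (inl u : T))%:R = (q%:R + 1) * (degree u)%:R :> R.
Proof.
rewrite degreeE sum_neighbors_old -degreeE.
under [X in _ + X]eq_bigr do rewrite sumr_const card_ord.
rewrite -(big_sub_cond _ (fun A : {set G} => u \in A) (fun=> q%:R)).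
rewrite sum_incident_edges sumr_const -mulr_natr -cardsE -/(degree u); ring.
Qed.

Lemma degree_new (A : E) (i : 'I_q) : (degree (inr (A, i) : T))%:R = 2 :> R.
Proof.
by rewrite degreeE sum_neighbors_new sumr_const (card_edge (valP A)).
Qed.

Lemma triangulation_connected : sconnected G -> sconnected T.
Proof.
case=> /card_gt0P[o _] Gc; split; first by apply/card_gt0P; exists (inl o).
have old u v : connect (@sedge T) (inl u) (inl v).
  have /connectP[s us ->] := Gc u v.
  elim: s u us => [|w s IHs] u //= /andP[uw /IHs]; apply: connect_trans.
  exact: connect1.
have new a : exists u, connect (@sedge T) a (inl u).
  case: a => [u|[A i]]; first by exists u; apply: connect0.
  have /edgesP[p _ Ap] := valP A; exists p.1; apply: connect1.
  by rewrite /= Ap set21.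
move=> a b; have [[u au] [v bv]] := (new a, new b).
apply: connect_trans au _; apply: connect_trans (old u v) _.
by rewrite (sym_connect_sym (@sedge_sym T)).
Qed.

(** * Extension to the new nodes by averaging *)

(** The extension of [f] from the old nodes to the node [a] of the
    triangulation. As a functional of [f] it is also the charge on the old nodes
    equivalent to a unit charge at [a]; both readings are used. *)
Definition endpoint_mean (a : T) (f : G -> R) : R :=
  match a with
  | inl u => f u
  | inr (A, _) => 2^-1 * \sum_(w in val A) f w
  end.

Lemma endpoint_mean_sumr (I : finType) (P : pred I) (a : T) (f : I -> G -> R) :
  \sum_(y | P y) endpoint_mean a (f y)
    = endpoint_mean a (fun w => \sum_(y | P y) f y w).
Proof.
case: a => [//|[A i]] /=; rewrite -mulr_sumr; congr (_ * _).
exact: exchange_big.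
Qed.

Lemma endpoint_meanB (a : T) (f f' : G -> R) :
  endpoint_mean a (fun w => f w - f' w) = endpoint_mean a f - endpoint_mean a f'.
Proof. by case: a => [//|[A i]] /=; rewrite sumrB mulrBr. Qed.

Lemma eq_endpoint_mean (a : T) (f f' : G -> R) :
  f =1 f' -> endpoint_mean a f = endpoint_mean a f'.
Proof.
by move=> ff; case: a => [u|[A i]] /=; rewrite ?ff //; under eq_bigr do rewrite ff.
Qed.

Lemma endpoint_mean_const (a : T) (x : R) : endpoint_mean a (fun=> x) = x.
Proof.
case: a => [//|[A i]] /=; rewrite sumr_const (card_edge (valP A)) -[_ *+ 2]mulr_natr.
by field.
Qed.

(** An old node [w] counts [q + 1] times its degree [d], and each of the [q d]
    new nodes next to it contributes its degree 2 times the weight 1/2 of [w];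
    altogether [(2 q + 1) d]. *)
Lemma sum_degree_endpoint_mean (f : G -> R) :
  \sum_(a : T) (degree a)%:R * endpoint_mean a f
    = (2 * q%:R + 1) * \sum_(w : G) (degree w)%:R * f w.
Proof.
rewrite sum_vertices /=.
under eq_bigr do rewrite degree_old -mulrA.
under [X in _ + X]eq_bigr => A _.
  under eq_bigr do rewrite degree_new mulVKf ?pnatr_eq0 //.
  rewrite sumr_const card_ord -[_ *+ q]mulr_natl; over.
rewrite -!mulr_sumr -(big_sub _ (fun A : {set G} => \sum_(w in A) f w)).
rewrite sum_edge_ends.
under [X in _ + q%:R * X]eq_bigr => w _.
  rewrite -[f w]mul1r -mulr_suml -degreeE; over.
by ring.
Qed.

(** An extended potential is balanced at the new nodes, which sit halfway between
    their neighbours. Along each of the [q] paths parallel to [uv] it drops by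
    [(f u - f v) / 2] on the first edge, so the current at [u] is [1 + q / 2]
    times the one in [G]. *)
Lemma net_current_endpoint_mean (f : G -> R) (x : T) :
  \sum_(c | sedge x c) (endpoint_mean x f - endpoint_mean c f) =
  if x is inl u then (q%:R + 2) / 2 * \sum_(v | sedge u v) (f u - f v) else 0.
Proof.
case: x => [u|[A i]].
  rewrite sum_neighbors_old /=.
  under [X in _ + X]eq_bigr do rewrite sumr_const card_ord -[_ *+ q]mulr_natl.
  rewrite -mulr_sumr -(big_sub_cond _ (fun A : {set G} => u \in A)
    (fun A => f u - 2^-1 * \sum_(w in A) f w)) sum_incident_edges.
  have -> : \sum_(v | sedge u v) (f u - 2^-1 * \sum_(w in [set u; v]) f w)
      = 2^-1 * \sum_(v | sedge u v) (f u - f v).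
    rewrite mulr_sumr; apply: eq_bigr => v /sedge_neq uv.
    by rewrite sum_set2 //; field.
  by field.
rewrite sum_neighbors_new /= sumrB sumr_const (card_edge (valP A)) -[_ *+ 2]mulr_natr.
by field.
Qed.

Definition new_vertex (a : T) : bool := if a is inr _ then true else false.

(** * The Green function of a triangulation *)

Section LiftedGreen.
Variables (o : G) (h : G -> G -> R).
Hypothesis h_Green : grounded_Green o h.

Definition mean_Green (a c : T) : R :=
  endpoint_mean c (fun z => endpoint_mean a (fun w => h w z)).

(** The factor [2 / (q + 2)] is the resistance of an edge in parallel with [q]
    paths of resistance 2. The second term raises a new node [a] above the
    average of its two neighbours by 1/2, the potential at which the unit
    current injected in [a] leaves through its two edges. *)
Definition triangulation_Green (a c : T) : R :=
  2 / (q%:R + 2) * mean_Green a c + 2^-1 * (new_vertex a && (c == a))%:R.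

Lemma endpoint_mean_indicator (a : T) (u : G) :
  endpoint_mean a (fun w => (u == w)%:R) =
  (inl u == a)%:R + 2^-1 * (new_vertex a && sedge (inl u : T) a)%:R.
Proof.
case: a => [t|[A i]] /=; first by rewrite mulr0 addr0.
by under eq_bigr do rewrite eq_sym; rewrite sum_indicator add0r.
Qed.

(** At an old node [u], apart from the unit leaving at the ground, the extended
    part has as net current the charge equivalent to [a]. For a new node [a]
    this is 1/2 at its two neighbours, exactly what flows into them because of
    the raised potential at [a]. *)
Lemma triangulation_Green_grounded :
  grounded_Green (inl o : T) triangulation_Green.
Proof.
have q2 := natr_add2_neq0 R q.
move=> a x; rewrite /triangulation_Green /mean_Green.
set Phi := fun z => endpoint_mean a (fun w => h w z).
transitivity (2 / (q%:R + 2) *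
    \sum_(c | sedge x c) (endpoint_mean x Phi - endpoint_mean c Phi)
  + 2^-1 * (new_vertex a)%:R *
    ((degree x)%:R * (x == a)%:R - \sum_(c | sedge x c) (c == a)%:R)).
  rewrite degreeE mulr_suml -sumrB !mulr_sumr -big_split /=.
  by apply: eq_bigr => c _; rewrite -!mulnb !natrM; ring.
rewrite net_current_endpoint_mean (sum_indicator _ (sedge x)).
case: x => [u|[B j]].
  have -> : \sum_(v | sedge u v) (Phi u - Phi v)
      = endpoint_mean a (fun w => (u == w)%:R) - (u == o)%:R.
    rewrite -[X in _ - X](endpoint_mean_const a) -endpoint_meanB.
    rewrite -(eq_endpoint_mean a (fun w => h_Green w u)) -endpoint_mean_sumr.
    by apply: eq_bigr => v _; rewrite endpoint_meanB.
  rewrite endpoint_mean_indicator -mulnb natrM.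
  (* The diagonal term vanishes because [inl u] is not new. *)
  rewrite -[2^-1 * _ * _]mulrA.
  have -> : (new_vertex a)%:R * ((degree (inl u : T))%:R * (inl u == a)%:R
      - (sedge (inl u : T) a)%:R)
      = - ((new_vertex a)%:R * (sedge (inl u : T) a)%:R) :> R.
    by case: a {Phi} => [t|A] /=; ring.
  by field.
rewrite degree_new; case: a {Phi} => [t|A] /=.
  by rewrite !(mulr0, mul0r, addr0, subr0).
by field.
Qed.

(** On an edge [wv], half of [h w w + h w v + h v w + h v v] falls short of
    [h w w + h v v] by half of [(h w w - h w v) + (h v v - h v w)], whose sum
    over all edges is given by [Foster]. *)
Lemma sum_degree_mean_Green_diag :
  \sum_(a : T) (degree a)%:R * mean_Green a a =
  (2 * q%:R + 1) * \sum_(w : G) (degree w)%:R * h w w - q%:R * (#|G|%:R - 1) / 2.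
Proof.
set H := \sum_w _ * h w w; rewrite sum_vertices /mean_Green /=.
under eq_bigr do rewrite degree_old -mulrA.
under [X in _ + X]eq_bigr => A _.
  under eq_bigr do rewrite degree_new mulVKf ?pnatr_eq0 //.
  rewrite sumr_const card_ord -[_ *+ q]mulr_natl; over.
rewrite -!mulr_sumr -/H.
(* The exchange puts the source [w] outside, where [Foster] expects it. *)
under [X in _ + _ * X]eq_bigr do rewrite -mulr_sumr exchange_big mulr_sumr /=.
rewrite -(big_sub _ (fun A : {set G} =>
  \sum_(w in A) 2^-1 * \sum_(z in A) h w z)).
rewrite sum_edge_ends -(Foster h_Green).
have -> : \sum_w \sum_(v | sedge w v)
      2^-1 * (\sum_(z in [set w; v]) h w z)
    = H - 2^-1 * \sum_w \sum_(v | sedge w v) (h w w - h w v).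
  rewrite mulr_sumr -sumrB; apply: eq_bigr => w _.
  rewrite degreeE mulr_suml mulr_sumr -sumrB; apply: eq_bigr => v /sedge_neq wv.
  by rewrite sum_set2 //; field.
by field.
Qed.

Lemma sum_degree_mean_Green :
  \sum_(a : T) \sum_(c : T) (degree a)%:R * (degree c)%:R * mean_Green a c =
  (2 * q%:R + 1) ^+ 2 *
    \sum_(x : G) \sum_(y : G) (degree x)%:R * (degree y)%:R * h x y.
Proof.
transitivity ((2 * q%:R + 1) * \sum_(z : G) (degree z)%:R *
    \sum_(a : T) (degree a)%:R * endpoint_mean a (h^~ z)).
  rewrite mulr_sumr; under [RHS]eq_bigr do rewrite !mulr_sumr.
  rewrite [RHS]exchange_big; apply: eq_bigr => a _.
  under [LHS]eq_bigr do rewrite -mulrA.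
  rewrite -mulr_sumr sum_degree_endpoint_mean !mulr_sumr.
  by apply: eq_bigr => z _; ring.
under eq_bigr do rewrite sum_degree_endpoint_mean.
rewrite exchange_big !mulr_sumr; apply: eq_bigr => z _.
by rewrite !mulr_sumr; apply: eq_bigr => w _; ring.
Qed.

End LiftedGreen.

Lemma card_edges_triangulation :
  #|edges T|%:R = (2 * q%:R + 1) * #|edges G|%:R :> R.
Proof.
have two_neq0 : 2 != 0 :> R by rewrite pnatr_eq0.
apply: (mulfI two_neq0).
transitivity ((\sum_(a : T) degree a)%:R : R); first by rewrite handshake natrM.
rewrite natr_sum.
transitivity (\sum_(a : T) (degree a)%:R * endpoint_mean a (fun=> 1)).
  by apply: eq_bigr => a _; rewrite endpoint_mean_const mulr1.
rewrite sum_degree_endpoint_mean; under eq_bigr do rewrite mulr1.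
by rewrite -natr_sum handshake natrM mulrCA.
Qed.

Lemma card_triangulation : #|T| = (#|G| + #|edges G| * q)%N.
Proof.
by rewrite [LHS]card_sum card_prod card_sig card_ord; congr (_ + _ * _)%N.
Qed.

End OneStep.

(** * One triangulation and its iterates *)

Section Recursion.
Variables (R : realFieldType) (q : nat) (G : sgraph).
Notation T := (triangulation q G).

Lemma sum_new_vertices (f : T -> R) (x : R) :
  (forall A i, f (inr (A, i)) = x) ->
  \sum_(a : T) (new_vertex a)%:R * f a = #|edges G|%:R * q%:R * x.
Proof.
move=> fx; rewrite sum_vertices big1 ?add0r => [|u _]; last by rewrite mul0r.
under eq_bigr do under eq_bigr do rewrite fx mul1r.
under eq_bigr do rewrite sumr_const card_ord.
by rewrite sumr_const card_sig -[x *+ q]mulr_natl -[_ *+ #|_|]mulr_natl mulrA.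
Qed.

(** The corrections of 1/2 at the [m q] new nodes, which have degree 2, add [m q]
    to the trace and [2 m q] to the sum of all entries. *)
Lemma Kirchhoff_triangulation : sconnected G ->
  mult_degree_Kirchhoff R T =
    2 * (2 * q%:R + 1) ^+ 2 / (q%:R + 2) * mult_degree_Kirchhoff R G
    + 2 * q%:R * #|edges G|%:R *
      ((2 * q%:R + 1) * #|edges G|%:R - 1
       - (2 * q%:R + 1) * (#|G|%:R - 1) / (q%:R + 2)).
Proof.
move=> Gc; have q2 := natr_add2_neq0 R q.
have /card_gt0P[o _] := Gc.1.
have hG := grounded_Green_exists R o Gc; set h : G -> G -> R := fun a => _ in hG.
rewrite (Kirchhoff_Green (triangulation_connected q Gc)
  (triangulation_Green_grounded (q := q) hG)).
rewrite (Kirchhoff_Green Gc hG) card_edges_triangulation /triangulation_Green.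
have -> : \sum_(a : T) (degree a)%:R * (2 / (q%:R + 2) * mean_Green h a a
      + 2^-1 * (new_vertex a && (a == a))%:R)
    = 2 / (q%:R + 2) * (\sum_(a : T) (degree a)%:R * mean_Green h a a)
      + #|edges G|%:R * q%:R * 1.
  rewrite -(@sum_new_vertices (fun a => 2^-1 * (degree a)%:R)).
    rewrite mulr_sumr -big_split; apply: eq_bigr => a _ /=.
    by rewrite eqxx andbT; ring.
  by move=> A i; rewrite degree_new; field.
have -> : \sum_(a : T) \sum_(c : T) (degree a)%:R * (degree c)%:R *
      (2 / (q%:R + 2) * mean_Green h a c
        + 2^-1 * (new_vertex a && (c == a))%:R)
    = 2 / (q%:R + 2) * (\sum_(a : T) \sum_(c : T)
        (degree a)%:R * (degree c)%:R * mean_Green h a c)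
      + #|edges G|%:R * q%:R * 2.
  rewrite -(@sum_new_vertices (fun a => 2^-1 * (degree a)%:R ^+ 2)).
    rewrite mulr_sumr -big_split; apply: eq_bigr => a _ /=.
    have -> : (new_vertex a)%:R * (2^-1 * (degree a)%:R ^+ 2) =
        \sum_(c : T) (degree a)%:R * (degree c)%:R *
          (2^-1 * (new_vertex a && (c == a))%:R) :> R.
      rewrite (bigD1 a) //= eqxx andbT big1 => [|c /negPf ->]; first by ring.
      by rewrite andbF !mulr0.
    by rewrite mulr_sumr -big_split; apply: eq_bigr => c _ /=; ring.
  by move=> A i; rewrite degree_new; field.
rewrite (sum_degree_mean_Green_diag q hG) sum_degree_mean_Green.
by field.
Qed.

End Recursion.

Lemma iter_triangulation_connected (q k : nat) (G : sgraph) :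
  sconnected G -> sconnected (iter_triangulation q k G).
Proof. by move=> Gc; elim: k => //= k; apply: triangulation_connected. Qed.

Lemma card_edges_iter_triangulation (R : realFieldType) (q k : nat) (G : sgraph) :
  #|edges (iter_triangulation q k G)|%:R
    = (2 * q%:R + 1) ^+ k * #|edges G|%:R :> R.
Proof.
elim: k => [|k IHk]; first by rewrite mul1r.
by rewrite [LHS]card_edges_triangulation IHk exprS mulrA.
Qed.

(** One step adds [2 q m] edges and [q m] nodes. *)
Lemma edge_excess_iter_triangulation (R : realFieldType) (q k : nat) (G : sgraph) :
  let H := iter_triangulation q k G in
  #|edges H|%:R - 2 * #|H|%:R = #|edges G|%:R - 2 * #|G|%:R :> R.
Proof.
elim: k => //= k <-.
rewrite card_edges_triangulation card_triangulation natrD natrM; ring.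
Qed.

Theorem theorem10 (R : realFieldType) (G : sgraph) (n m q k : nat)
    (G_connected : sconnected G) (G_nodes : #|G| = n) (G_edges : #|edges G| = m)
    (q_ge1 : (1 <= q)%N) :
  let Q : R := 2 * q%:R + 1 in
  let rho : R := 2 * Q ^+ 2 / (q%:R + 2) in
  mult_degree_Kirchhoff R (iter_triangulation q k G) =
    rho ^+ k * mult_degree_Kirchhoff R G
    + m%:R ^+ 2 * (2 * q%:R + 3) / Q * (Q ^+ (2 * k) - rho ^+ k)
    + (2 * m%:R * (q%:R - 1) / (3 * Q) + m%:R * (m%:R - 2 * n%:R) / 3)
      * (rho ^+ k - Q ^+ k).
Proof.
move=> Q rho; rewrite -{}G_nodes -{}G_edges.
have q2 := natr_add2_neq0 R q.
have Q0 : Q != 0 by rewrite /Q -natrM natr1 pnatr_eq0.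
elim: k => [|k IHk]; first by rewrite muln0 !expr0; ring.
have := edge_excess_iter_triangulation R q k G; set H := iter_triangulation q k G.
(* Eliminating the number of nodes leaves only powers of [Q] and [rho]. *)
move=> /= excess; have nodes : #|H|%:R =
    (#|edges H|%:R - (#|edges G|%:R - 2 * #|G|%:R)) / 2 :> R.
  by rewrite -excess; field.
rewrite [LHS](@Kirchhoff_triangulation R q H); last first.
  exact: iter_triangulation_connected.
rewrite -/Q -/rho IHk nodes card_edges_iter_triangulation -/Q.
rewrite mulnS exprD [(2 * k)%N]mulnC exprM ![_ ^+ k.+1]exprS.
set z := Q ^+ k; set w := rho ^+ k; rewrite /rho /Q in Q0 *.
by field; rewrite q2 Q0.
Qed.
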